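(* For every integer $k\geqslant 1$, we have $t(k)\geqslant \log_2(k+2)$.
   Context: Words are finite sequences of letters over a finite alphabet. A factor of a word $W$ is a word $F$ such that $W=AFB$ for some (possibly empty) words $A,B$. A tangram is a word in which every letter occurs an even number of times (possibly zero). The cut number $\mu(T)$ of a tangram $T$ is the least integer $k\geqslant 1$ such that $T=F_1F_2\cdots F_{k+1}$, where the $F_i$ are nonempty words satisfying $F_{\sigma(1)}\cdots F_{\sigma(j)}=F_{\sigma(j+1)}\cdots F_{\sigma(k+1)}$ for some permutation $\sigma$ of $\{1,2,\ldots,k+1\}$ and some $1\leqslant j\leqslant k$. By convention $\mu(W)=\infty$ if $W$ is not a tangram, and also if $W$ is the empty word. A word $W$ is $k$-tangram-free if every factor $F$ of $W$ satisfies $\mu(F)\geqslant k+1$. For $k\geqslant 1$, $t(k)$ denotes the least size of an alphabet over which there exist arbitrarily long $k$-tangram-free words. *)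

(* Defs.v *)
From mathcomp Require Import all_boot all_order all_algebra all_fingroup.
From mathcomp Require Import all_classical all_reals all_analysis.

Set Implicit Arguments.
Unset Strict Implicit.
Unset Printing Implicit Defensive.

Import Order.TTheory GRing.Theory Num.Theory.

Local Open Scope classical_set_scope.
Local Open Scope ring_scope.
Local Open Scope ereal_scope.

Definition tangram (A : eqType) (W : seq A) : Prop :=
  forall x : A, ~~ odd (count_mem x W).

Definition cuttable (A : eqType) (W : seq A) (k : nat) : Prop :=
  exists (F : k.+1.-tuple (seq A)) (s : 'S_k.+1) (j : nat),
    let G := [tuple tnth F (s i) | i < k.+1] in
    [/\ forall i, tnth F i <> [::],
        W = flatten F,
        (1 <= j <= k)%N &
        flatten (take j G) = flatten (drop j G)].

(* Least element of a set of naturals, +oo for the empty set. *)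
Definition least (R : realType) (P : set nat) : \bar R :=
  ereal_inf [set n%:R%:E | n in P].

(* On non-tangrams and on the empty word the set is empty, so the value is
   +oo. *)
Definition cut_number (R : realType) (A : eqType) (W : seq A) : \bar R :=
  least R [set k | [/\ tangram W, W <> [::], (1 <= k)%N & cuttable W k]].

Definition tangram_free (R : realType) (A : eqType) (k : nat) (W : seq A) :
    Prop :=
  forall F : seq A, infix F W -> k.+1%:R%:E <= cut_number R F.

Definition arbitrarily_long_tangram_free (R : realType) (k : nat)
    (A : finType) : Prop :=
  forall N : nat, exists W : seq A, (N <= size W)%N /\ tangram_free R k W.

(* The value +oo would mean that no finite alphabet is large enough. *)
Definition t (R : realType) (k : nat) : \bar R :=
  least R [set n | exists A : finType,
                     #|A| = n /\ arbitrarily_long_tangram_free R k A].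

Definition log2 (R : realType) (x : R) : R := (ln x / ln 2)%R.

(* Main.v *)
(* Over n letters, a word of length at least 2^n has 2^n + 1 prefixes of length
   at most 2^n, two of which agree in the parities of all letter counts. The
   factor between them is a nonempty tangram of some length L <= 2^n. Cutting
   it into single letters uses L - 1 cuts and lets each half receive half of
   the occurrences of every letter, so its cut number is at most 2^n - 1.
   Hence k + 1 <= 2^n - 1 whenever long k-tangram-free words exist. *)
Require Import Defs.
From mathcomp Require Import all_boot all_order all_algebra all_fingroup.
From mathcomp Require Import all_classical all_reals all_analysis.

Import Order.TTheory GRing.Theory Num.Theory.

Local Open Scope ring_scope.
Local Open Scope ereal_scope.

(** Half of the occurrences of each letter, listed in the order of [enum A], form [u]; evenness
    makes the halving exact. *)
Lemma tangram_perm_double {A : finType} {W : seq A} :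
  tangram W -> exists u : seq A, perm_eq (u ++ u) W.
Proof.
move=> tW; exists (flatten [seq nseq (count_mem x W)./2 x | x <- enum A]).
apply/allP => x _ /=; apply/eqP; rewrite count_cat.
have -> : count_mem x (flatten [seq nseq (count_mem y W)./2 y | y <- enum A])
          = (count_mem x W)./2.
  rewrite count_flatten -map_comp sumnE big_map big_enum /= (bigD1 x) //=.
  rewrite count_nseq /= eqxx mul1n big1 ?addn0 // => y yx.
  by rewrite count_nseq /= (negbTE yx).
by rewrite addnn even_halfK.
Qed.

(** The one-letter pieces of [W] can be permuted to spell [u ++ u]; splitting after [size u] pieces
    leaves [u] on both sides. *)
Lemma cuttable_letters {A : finType} {W : seq A} {k : nat} :
  tangram W -> size W = k.+1 -> cuttable W k.
Proof.
move=> tW sW.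
have [u uW] := tangram_perm_double tW.
have su : (size u + size u = k.+1)%N by rewrite -size_cat (perm_size uW).
pose letters := [tuple of [seq [:: x] | x <- tcast sW (in_tuple W)]].
have /tuple_permP[s us] : perm_eq [seq [:: x] | x <- u ++ u] letters.
  by rewrite /= val_tcast perm_map.
exists letters, s, (size u) => /=.
rewrite -us map_cat take_size_cat ?size_map// drop_size_cat ?size_map//.
split=> //.
- by move=> i; rewrite tnth_map.
- by rewrite val_tcast /= flatten_seq1.
(* Since [size u + size u = k.+1], the split index lies between 1 and [k]. *)
- by case: (size u) su => // m; rewrite addnS => -[<-]; rewrite ltn0Sn leq_addr.
Qed.

Lemma short_tangram_infix {A : finType} {W : seq A} :
  (2 ^ #|A| <= size W)%N ->
  exists F : seq A,
    [/\ infix F W, tangram F, F <> [::] & (size F <= 2 ^ #|A|)%N].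
Proof.
move=> hW.
(* The prefix lengths from 0 to [2 ^ #|A|] outnumber the parity vectors by one. *)
pose parity (i : 'I_(2 ^ #|A|).+1) : {ffun A -> bool} :=
  [ffun x => odd (count_mem x (take i W))].
have /injectivePn[i [j]] : ~~ injectiveb parity.
  apply/negP => /injectiveP /leq_card.
  by rewrite card_ord card_ffun card_bool ltnn.
wlog ij : i j / (i < j)%N.
  move=> H ne eqp; have [lt|gt|/val_inj e] := ltngtP i j.
  - exact: H ne eqp.
  - by apply: (H j i) => //; rewrite eq_sym.
  - by rewrite e eqxx in ne.
move=> _ /ffunP eqp.
have jW : (j <= size W)%N by apply: leq_trans hW; rewrite -ltnS.
have sF : size (drop i (take j W)) = (j - i)%N by rewrite size_drop size_takel.
exists (drop i (take j W)); split.
- by apply: infix_trans (infix_drop _ _) (infix_take _ _).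
- move=> x; have := eqp x; rewrite !ffunE.
  (* Only the longer prefix in the parity equation is split, so that the shorter one cancels. *)
  have {1}<- : take i (take j W) ++ drop i (take j W) = take j W.
    exact: cat_take_drop.
  by rewrite count_cat oddD take_takel ?(ltnW ij)//; case: odd; case: odd.
- by move=> F0; move: sF; rewrite F0 => /esym/eqP; rewrite subn_eq0 leqNgt ij.
- by rewrite sF; apply: leq_trans (leq_subr _ _) _; rewrite -ltnS.
Qed.

(** A lone letter has odd count. This ensures that cutting into letters uses at least one cut. *)
Lemma tangram_size_gt1 {A : eqType} {F : seq A} :
  tangram F -> F <> [::] -> (1 < size F)%N.
Proof. by case: F => [//|x [|//]] /(_ x) /=; rewrite eqxx. Qed.

Lemma cut_number_le_size (R : realType) {A : finType} {F : seq A} :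
  tangram F -> F <> [::] -> cut_number R F <= (size F).-1%:R%:E.
Proof.
move=> tF F0; have F1 := tangram_size_gt1 tF F0.
apply: ereal_inf_lbound; exists (size F).-1 => //; split=> //.
- by rewrite -ltnS prednK// ltnW.
- by apply: cuttable_letters => //; rewrite prednK// ltnW.
Qed.

Lemma tangram_free_alphabet_size {R : realType} {k : nat} {A : finType} :
  arbitrarily_long_tangram_free R k A -> (k + 2 <= 2 ^ #|A|)%N.
Proof.
move=> /(_ (2 ^ #|A|)%N)[W [hW freeW]].
have [F [FW tF F0 sF]] := short_tangram_infix hW.
apply: leq_trans sF.
have := le_trans (freeW F FW) (cut_number_le_size _ tF F0).
rewrite lee_fin ler_nat addn2.
by have := tangram_size_gt1 tF F0; case: (size F).
Qed.

Theorem corollary1 (R : realType) (k : nat) (hk : (1 <= k)%N) :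
  (log2 ((k + 2)%:R : R))%:E <= t R k.
Proof.
(* As [t] is an infimum, it suffices to bound each admissible alphabet size; this also covers the
   value [+oo]. *)
apply: le_ereal_inf_tmp => _ [n [A [<- longA]] <-].
have ln2_gt0 : (0 < ln (2 : R))%R by rewrite ln_gt0// ltr1n.
rewrite lee_fin /log2 ler_pdivrMr// mulr_natl -lnXn// -natrX.
rewrite ler_ln ?posrE ?ltr0n ?expn_gt0 ?addn2//.
by rewrite ler_nat -addn2; exact: tangram_free_alphabet_size longA.
Qed.
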